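(* Let $(X,\mathcal{A})$ be a measurable space, let $\mu\colon\mathcal{A}\to[0,\infty]$ be a nonadditive measure, and let $0<p<\infty$ and $0<q<\infty$. Assume that $\mu$ is relaxed subadditive, monotone autocontinuous from below, and has property (C). Then $\mathcal{L}^{p,q}(\mu)$ is complete with respect to the quasi-seminorm $\|\cdot\|_{p,q}$ and $L^{p,q}(\mu)$ is complete with respect to the quasi-norm $\|\cdot\|_{p,q}$.
   Context: $X$ is a nonempty set and $\mathcal{A}$ is a $\sigma$-field of subsets of $X$. A nonadditive measure is a set function $\mu\colon\mathcal{A}\to[0,\infty]$ with $\mu(\emptyset)=0$ and $\mu(A)\le\mu(B)$ whenever $A,B\in\mathcal{A}$, $A\subset B$. $\mathcal{F}_0(X)$ is the real linear space of all $\mathcal{A}$-measurable functions $X\to\mathbb{R}$. Relaxed subadditive: there is a constant $K\ge 1$ such that $\mu(A\cup B)\le K\{\mu(A)+\mu(B)\}$ for every disjoint $A,B\in\mathcal{A}$. Monotone autocontinuous from below: $\mu(A\setminus B_n)\to\mu(A)$ whenever $A,B_n\in\mathcal{A}$, $\{B_n\}_{n\in\mathbb{N}}$ is nonincreasing, and $\mu(B_n)\to 0$. (This implies null-additivity: $\mu(A\cup B)=\mu(A)$ whenever $\mu(B)=0$.) Property (C): for any sequence $\{E_n\}_{n\in\mathbb{N}}\subset\mathcal{A}$, if $\sup_{l\in\mathbb{N}}\mu\left(\bigcup_{n=k}^{k+l}E_n\right)\to 0$ as $k\to\infty$, then $\mu\left(\bigcup_{n=k}^\infty E_n\right)\to 0$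 as $k\to\infty$. Choquet integral: $\mathrm{Ch}(\nu,g):=\int_0^\infty\nu(\{g>t\})\,dt\in[0,\infty]$ for a nonadditive measure $\nu$ and measurable $g\colon X\to[0,\infty)$. With $\mu^{q/p}(A):=\mu(A)^{q/p}$, define for $f\in\mathcal{F}_0(X)$ $$\|f\|_{p,q}:=\left(\frac{p}{q}\right)^{1/q}\mathrm{Ch}(\mu^{q/p},|f|^q)^{1/q}\in[0,\infty],$$ and $\mathcal{L}^{p,q}(\mu):=\{f\in\mathcal{F}_0(X):\|f\|_{p,q}<\infty\}$. $f\sim g$ iff $\mu(\{|f-g|>c\})=0$ for every $c>0$; this is an equivalence relation on $\mathcal{F}_0(X)$ here; $[f]$ is the class of $f$, with $[f]+[g]:=[f+g]$, $c[f]:=[cf]$. $L^{p,q}(\mu):=\{[f]: f\in\mathcal{L}^{p,q}(\mu)\}$ and $\|[f]\|_{p,q}:=\|f\|_{p,q}$ (well-defined since $\mu$ is null-additive). On a real linear space $V$, a quasi-seminorm is a function $\|\cdot\|\colon V\to[0,\infty)$ with $\|cx\|=|c|\|x\|$ for all $x\in V$, $c\in\mathbb{R}$, and $\|x+y\|\le K'\{\|x\|+\|y\|\}$ for all $x,y\in V$ and some constant $K'\ge1$; a quasi-norm is a quasi-seminorm such that $\|x\|=0$ implies $x=0$. Convergence $x_n\to x$ means $\|x_n-x\|\to 0$; $\{x_n\}$ is Cauchy if for any $\varepsilon>0$ there is $n_0$ with $\|x_m-x_n\|<\varepsilon$ for $m,n\ge n_0$; complete means every Cauchy sequence in the space converges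 to an element of the space. *)

(* Defs.v *)
From HB Require Import structures.
From mathcomp Require Import all_boot all_order all_algebra.
From mathcomp Require Import generic_quotient.
From mathcomp Require Import all_classical all_reals all_analysis.
From mathcomp Require Import measurable_realfun.

Set Implicit Arguments.
Unset Strict Implicit.
Unset Printing Implicit Defensive.

Import Order.TTheory GRing.Theory Num.Theory.
Import numFieldNormedType.Exports.

Local Open Scope classical_set_scope.
Local Open Scope ring_scope.
Local Open Scope ereal_scope.

Section quasi_normed_subspaces.
Context (R : realType) (V : lmodType R).

(* The real linear space is a linear subspace S of an ambient space V, and the
   quasi-seminorm an extended-real function on V that is finite on S. *)
Record quasi_seminorm_on (S : set V) (N : V -> \bar R) : Prop := {
  qsn_sub0 : S 0%R ;
  qsn_subD : forall x y, S x -> S y -> S (x + y)%R ;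
  qsn_subZ : forall (c : R) x, S x -> S (c *: x)%R ;
  qsn_ge0 : forall x, S x -> 0 <= N x ;
  qsn_fin : forall x, S x -> N x < +oo ;
  qsn_homogeneous : forall (c : R) x, S x -> N (c *: x)%R = `|c|%:E * N x ;
  qsn_triangle : exists2 K : R, (1 <= K)%R &
    forall x y, S x -> S y -> N (x + y)%R <= K%:E * (N x + N y) }.

Definition quasi_norm_on (S : set V) (N : V -> \bar R) : Prop :=
  quasi_seminorm_on S N /\ forall x, S x -> N x = 0 -> x = 0%R.

Definition cauchy_wrt (N : V -> \bar R) (x : nat -> V) : Prop :=
  forall e : R, (0 < e)%R -> exists n0 : nat, forall m n : nat,
    (n0 <= m)%N -> (n0 <= n)%N -> N (x m - x n)%R < e%:E.

Definition complete_wrt (S : set V) (N : V -> \bar R) : Prop :=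
  forall x : nat -> V, (forall n, S (x n)) -> cauchy_wrt N x ->
    exists2 y, S y & (fun n => N (x n - y)%R) @ \oo --> (0 : \bar R).

End quasi_normed_subspaces.

Section nonadditive_measures.
Context d (T : measurableType d) (R : realType).
Implicit Types mu : set T -> \bar R.

(* Values of mu on non-measurable sets are unconstrained and never used. *)
Record nonadditive_measure mu : Prop := {
  nam_set0 : mu set0 = 0 ;
  nam_ge0 : forall A, measurable A -> 0 <= mu A ;
  nam_le : forall A B, measurable A -> measurable B -> A `<=` B ->
    mu A <= mu B }.

Definition relaxed_subadditive mu : Prop :=
  exists2 K : R, (1 <= K)%R & forall A B, measurable A -> measurable B ->
    A `&` B = set0 -> mu (A `|` B) <= K%:E * (mu A + mu B).

Definition monotone_autocontinuous_from_below mu : Prop :=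
  forall (A : set T) (B : nat -> set T),
    measurable A -> (forall n, measurable (B n)) ->
    (forall n, B n.+1 `<=` B n) ->
    (fun n => mu (B n)) @ \oo --> (0 : \bar R) ->
    (fun n => mu (A `\` B n)) @ \oo --> mu A.

Definition property_C mu : Prop :=
  forall E : nat -> set T, (forall n, measurable (E n)) ->
    (fun k => ereal_sup
       (range (fun l => mu (\bigcup_(n in [set n | (k <= n <= k + l)%N]) E n))))
      @ \oo --> (0 : \bar R) ->
    (fun k => mu (\bigcup_(n >= k) E n)) @ \oo --> (0 : \bar R).

Definition choquet (nu : set T -> \bar R) (g : T -> R) : \bar R :=
  \int[lebesgue_measure]_(t in `[0%R, +oo[) nu [set x | (t < g x)%R].

Definition lorentz_norm mu (p q : R) (f : T -> R) : \bar R :=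
  ((p / q)%R `^ q^-1%R)%R%:E *
  (choquet (fun A => mu A `^ (q / p)%R) (fun x => (`|f x| `^ q)%R)) `^ q^-1%R.

Definition lorentz_fun mu (p q : R) : set {mfun T >-> R} :=
  [set f | lorentz_norm mu p q f < +oo].

Definition mu_equiv mu (f g : {mfun T >-> R}) : Prop :=
  forall c : R, (0 < c)%R -> mu [set x | (c < `|f x - g x|)%R] = 0.

End nonadditive_measures.

Section measurable_functions_modulo.
Context d (T : measurableType d) (R : realType) (mu : set T -> \bar R).
Hypotheses (mu_na : nonadditive_measure mu) (mu_rs : relaxed_subadditive mu).

Local Notation F0 := {mfun T >-> R}.

Lemma measurable_norm_gt (f : F0) (c : R) :
  measurable [set x | (c < `|f x|)%R].
Proof.
have mf : measurable_fun setT (fun x => `|f x|%R).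
  exact: measurableT_comp.
rewrite [X in measurable X](_ : _ = setT `&` (fun x => `|f x|%R) @^-1` `]c, +oo[).
  by apply: mf => //; exact: measurable_itv.
by rewrite setTI; apply/seteqP; split => x /=; rewrite in_itv/= andbT.
Qed.

Lemma sub_null A B : measurable A -> measurable B -> A `<=` B ->
  mu B = 0 -> mu A = 0.
Proof.
move=> mA mB AB B0; apply/eqP; rewrite eq_le (nam_ge0 mu_na)// andbT.
by rewrite -B0 nam_le.
Qed.

Lemma null_setU A B : measurable A -> measurable B ->
  mu A = 0 -> mu B = 0 -> mu (A `|` B) = 0.
Proof.
move=> mA mB A0 B0; apply/eqP; rewrite eq_le nam_ge0 ?andbT//; last first.
  exact: measurableU.
have [K _ muK] := mu_rs.
have mD : measurable (B `\` A) by exact: measurableD.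
have -> : A `|` B = A `|` (B `\` A).
  by rewrite setDE setUIr setUCr setIT.
apply: (le_trans (muK _ _ mA mD _)); first by rewrite setDE setICA setICr setI0.
by rewrite A0 (sub_null mD mB _ B0) ?adde0 ?mule0//; exact: subDsetl.
Qed.

Lemma mu_equiv_refl (f : F0) : mu_equiv mu f f.
Proof.
move=> c c0; rewrite -(nam_set0 mu_na); congr mu.
apply/seteqP; split => x //=.
by rewrite subrr normr0 ltNge (ltW c0).
Qed.

Lemma mu_equiv_sym (f g : F0) : mu_equiv mu f g -> mu_equiv mu g f.
Proof.
move=> fg c /fg <-; congr mu.
by apply/seteqP; split => x /=; rewrite distrC.
Qed.

Lemma mu_equivD (f g f' g' : F0) :
  mu_equiv mu f f' -> mu_equiv mu g g' -> mu_equiv mu (f + g)%R (f' + g')%R.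
Proof.
move=> ff gg c c0; have c20 : (0 < c / 2)%R by rewrite divr_gt0.
apply: (sub_null _ _ _ (null_setU _ _ (ff _ c20) (gg _ c20))) => /=.
- exact: (measurable_norm_gt ((f + g) - (f' + g'))%R).
- by apply: measurableU; [exact: (measurable_norm_gt (f - f')%R)
                         |exact: (measurable_norm_gt (g - g')%R)].
- move=> x /= cx; apply/orP; apply: contraLR cx.
  rewrite negb_or -!leNgt => /andP[fx gx].
  rewrite opprD addrACA (le_trans (ler_normD _ _))// [leRHS](splitr c).
  exact: lerD.
- exact: (measurable_norm_gt (f - f')%R).
- exact: (measurable_norm_gt (g - g')%R).
Qed.

Lemma mu_equivZ (a : R) (f g : F0) :
  mu_equiv mu f g -> mu_equiv mu (a *: f)%R (a *: g)%R.
Proof.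
move=> fg c c0; have a0 : (0 < `|a| + 1)%R by rewrite ltr_wpDl.
apply: (sub_null _ _ _ (fg (c / (`|a| + 1))%R _)) => /=.
- exact: (measurable_norm_gt (a *: f - a *: g)%R).
- exact: (measurable_norm_gt (f - g)%R).
- move=> x /=; rewrite -scalerBr normrM ltr_pdivrMr// => /lt_le_trans; apply.
  by rewrite mulrC ler_wpM2l// lerDl.
- by rewrite divr_gt0.
Qed.

Lemma mu_equivN (f g : F0) : mu_equiv mu f g -> mu_equiv mu (- f)%R (- g)%R.
Proof.
by move=> fg; rewrite -[(- f)%R]scaleN1r -[(- g)%R]scaleN1r; exact: mu_equivZ.
Qed.

Lemma mu_equiv_trans (g f h : F0) :
  mu_equiv mu f g -> mu_equiv mu g h -> mu_equiv mu f h.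
Proof.
move=> fg gh; have := mu_equivD (mu_equivD fg gh) (mu_equiv_refl (- g)%R).
by rewrite -addrA subrr addr0 addrAC subrr add0r.
Qed.

Local Open Scope quotient_scope.

Definition mu_equivb (f g : F0) : bool := `[< mu_equiv mu f g >].

Lemma mu_equivb_refl : reflexive mu_equivb.
Proof. by move=> f; apply/asboolP; exact: mu_equiv_refl. Qed.

Lemma mu_equivb_sym : symmetric mu_equivb.
Proof.
by move=> f g; apply/idP/idP => /asboolP fg; apply/asboolP; exact: mu_equiv_sym.
Qed.

Lemma mu_equivb_trans : transitive mu_equivb.
Proof.
by move=> g f h /asboolP fg /asboolP gh; apply/asboolP; exact: mu_equiv_trans gh.
Qed.

Definition mu_equivr : equiv_rel F0 :=
  EquivRel mu_equivb mu_equivb_refl mu_equivb_sym mu_equivb_trans.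

Definition mfun_mod : Type := {eq_quot mu_equivr}.
HB.instance Definition _ := Choice.on mfun_mod.
HB.instance Definition _ := EqQuotient.on mfun_mod.

Lemma mfun_modP (f g : F0) :
  \pi_mfun_mod f = \pi_mfun_mod g <-> mu_equiv mu f g.
Proof.
split=> [/eqmodP/asboolP//|fg]; apply/eqmodP; exact/asboolP.
Qed.

Lemma repr_pi_equiv (f : F0) : mu_equiv mu (repr (\pi_mfun_mod f)) f.
Proof. by apply/mfun_modP; rewrite reprK. Qed.

Definition mod_zero : mfun_mod := \pi_mfun_mod 0%R.
Definition mod_opp := lift_op1 mfun_mod -%R.
Definition mod_add := lift_op2 mfun_mod +%R.
Definition mod_scale (a : R) := lift_op1 mfun_mod ( *:%R a).

Lemma pi_mod_opp (f : F0) :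
  mod_opp (\pi_mfun_mod f) = \pi_mfun_mod (- f)%R.
Proof. by unlock mod_opp; apply/mfun_modP/mu_equivN; exact: repr_pi_equiv. Qed.

Lemma pi_mod_add (f g : F0) :
  mod_add (\pi_mfun_mod f) (\pi_mfun_mod g) = \pi_mfun_mod (f + g)%R.
Proof. by unlock mod_add; apply/mfun_modP/mu_equivD; exact: repr_pi_equiv. Qed.

Lemma pi_mod_scale a (f : F0) :
  mod_scale a (\pi_mfun_mod f) = \pi_mfun_mod (a *: f)%R.
Proof. by unlock mod_scale; apply/mfun_modP/mu_equivZ; exact: repr_pi_equiv. Qed.

Lemma mod_addA : associative mod_add.
Proof.
by elim/quotW => f; elim/quotW => g; elim/quotW => h; rewrite !pi_mod_add addrA.
Qed.

Lemma mod_addC : commutative mod_add.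
Proof. by elim/quotW => f; elim/quotW => g; rewrite !pi_mod_add addrC. Qed.

Lemma mod_add0 : left_id mod_zero mod_add.
Proof. by elim/quotW => f; rewrite pi_mod_add add0r. Qed.

Lemma mod_addN : left_inverse mod_zero mod_opp mod_add.
Proof. by elim/quotW => f; rewrite pi_mod_opp pi_mod_add addNr. Qed.

HB.instance Definition _ :=
  GRing.isZmodule.Build mfun_mod mod_addA mod_addC mod_add0 mod_addN.

Lemma mod_scaleA a b u : mod_scale a (mod_scale b u) = mod_scale (a * b)%R u.
Proof. by elim/quotW: u => f; rewrite !pi_mod_scale scalerA. Qed.

Lemma mod_scale1 : left_id 1%R mod_scale.
Proof. by elim/quotW => f; rewrite pi_mod_scale scale1r. Qed.

Lemma mod_scaleDr : right_distributive mod_scale +%R.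
Proof.
move=> a; elim/quotW => f; elim/quotW => g.
rewrite -[(_ + _)%R]/(mod_add _ _) -[RHS]/(mod_add _ _).
by rewrite pi_mod_add !pi_mod_scale pi_mod_add scalerDr.
Qed.

Lemma mod_scaleDl u : {morph mod_scale^~ u : a b / (a + b)%R}.
Proof.
elim/quotW: u => f a b; rewrite -[RHS]/(mod_add _ _).
by rewrite !pi_mod_scale pi_mod_add scalerDl.
Qed.

HB.instance Definition _ := GRing.Zmodule_isLmodule.Build R mfun_mod
  mod_scaleA mod_scale1 mod_scaleDr mod_scaleDl.

Lemma pi_mfun_modD (f g : F0) :
  \pi_mfun_mod (f + g)%R = (\pi_mfun_mod f + \pi_mfun_mod g)%R.
Proof. exact/esym/pi_mod_add. Qed.

Lemma pi_mfun_modZ (a : R) (f : F0) :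
  \pi_mfun_mod (a *: f)%R = (a *: \pi_mfun_mod f)%R.
Proof. exact/esym/pi_mod_scale. Qed.

Definition lorentz_space (p q : R) : set mfun_mod :=
  [set \pi_mfun_mod f | f in lorentz_fun mu p q].

(* Independent of the representative: see lorentz_qnorm_pi. *)
Definition lorentz_qnorm (p q : R) (u : mfun_mod) : \bar R :=
  lorentz_norm mu p q (repr u).

End measurable_functions_modulo.

Arguments lorentz_space {d T R mu} mu_na mu_rs p q.
Arguments lorentz_qnorm {d T R mu} mu_na mu_rs p q u.

Section lorentz_norm_well_defined.
Context (R : realType).

Let nonincreasing_on_measurable (F : R -> \bar R) :
  (forall s t, (0 <= s)%R -> (s <= t)%R -> F t <= F s) ->
  measurable_fun (`[0%R, +oo[ : set R) F.
Proof.
move=> ndF; apply: (measurability (@ErealGenOInfty.G R)) => [|_ [_ [r ->] <-]].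
  exact: ErealGenOInfty.measurableE.
apply: is_interval_measurable => s t /= [s0 Fs] [t0 Ft] u /andP[su ut].
move: s0 Fs t0 Ft; rewrite /= !in_itv/= !andbT => s0 rs t0 rt.
have u0 := le_trans s0 su; split => //.
by apply: (lt_le_trans rt); apply: ndF.
Qed.

Let le_integral_right_shift (F G : R -> \bar R) :
  (forall t, 0 <= F t) -> (forall t, 0 <= G t) ->
  (forall s t, (0 <= s)%R -> (s <= t)%R -> F t <= F s) ->
  (forall s t, (0 <= s)%R -> (s <= t)%R -> G t <= G s) ->
  (forall s t, (0 <= s)%R -> (s < t)%R -> F t <= G s) ->
  \int[lebesgue_measure]_(t in `[0%R, +oo[) F t <=
  \int[lebesgue_measure]_(t in `[0%R, +oo[) G t.
Proof.
move=> F0 G0 ndF ndG FG.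
pose D : set R := [set t | (0 <= t)%R /\ G t < F t].
have rP t : exists r : rat, D t -> G t < (ratr r)%:E < F t.
  have [[t0 GF]|] := pselect (D t); last by exists 0%R.
  have Gfin : G t \is a fin_num by rewrite ge0_fin_numE// (lt_le_trans GF)// leey.
  case: (F t) GF => [y|_|]; last by rewrite ltNge leNye.
    rewrite -(fineK Gfin) lte_fin => /rat_in_itvoo[r]; rewrite in_itv/= => ry.
    by exists r; rewrite !lte_fin.
  have /rat_in_itvoo[r] : (fine (G t) < fine (G t) + 1)%R by rewrite ltrDl.
  rewrite in_itv/= => /andP[Gr _]; exists r => _.
  by rewrite -(fineK Gfin) lte_fin Gr ltry.
pose rr t := projT1 (cid (rP t)).
have rrP t : D t -> G t < (ratr (rr t))%:E < F t.
  by rewrite /rr; case: cid.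
have rr_lt s t : D s -> D t -> (s < t)%R -> (ratr (rr t) < ratr (rr s) :> R)%R.
  move=> Ds Dt st; have /andP[_ tF] := rrP _ Dt; have /andP[Gs _] := rrP _ Ds.
  by rewrite -lte_fin (lt_trans tF)// (le_lt_trans _ Gs)// FG//; case: Ds.
have cD : countable D.
  apply/countable_injP; exists (pickle \o rr) => s t /set_mem Ds /set_mem Dt /=.
  move=> /(pcan_inj (@pickleK _)) rst; apply/eqP; case: ltgtP => // st.
    by have := rr_lt _ _ Ds Dt st; rewrite rst ltxx.
  by have := rr_lt _ _ Dt Ds st; rewrite rst ltxx.
have mD : measurable D by exact: countable_measurable.
apply: ae_ge0_le_integral => //.
- exact: nonincreasing_on_measurable.
- exact: nonincreasing_on_measurable.
exists D; split => //; first exact: countable_lebesgue_measure0.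
move=> t /= /not_implyP[]; rewrite in_itv/= andbT => t0 /negP.
by rewrite -ltNge.
Qed.

Context d (T : measurableType d) (mu : set T -> \bar R).
Hypotheses (mu_na : nonadditive_measure mu) (mu_rs : relaxed_subadditive mu).
Hypothesis mu_ac : monotone_autocontinuous_from_below mu.
Variables p q : R.
Hypotheses (p0 : (0 < p)%R) (q0 : (0 < q)%R).

Lemma null_additive A B : measurable A -> measurable B -> mu B = 0 ->
  mu (A `|` B) = mu A.
Proof.
move=> mA mB B0; have mAB : measurable (A `|` B) by exact: measurableU.
apply/eqP; rewrite eq_le; apply/andP; split; last exact: (nam_le mu_na).
have /cvg_lim <-// : (fun _ : nat => mu ((A `|` B) `\` B)) @ \oo --> mu (A `|` B).
  apply: (mu_ac mAB (fun=> mB)) => [_|]; first exact: subset_refl.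
  by rewrite B0; exact: cvg_cst.
rewrite lim_cst//; apply: (nam_le mu_na) => //; first exact: measurableD.
by move=> x [[]].
Qed.

Let F (f : {mfun T >-> R}) (t : R) :=
  mu [set x | (t < `|f x| `^ q)%R] `^ (q / p)%R.

Let measurable_powR_gt (f : {mfun T >-> R}) t :
  measurable [set x | (t < `|f x| `^ q)%R].
Proof.
have mf : measurable_fun setT (fun x => `|f x| `^ q)%R.
  by apply: (measurableT_comp (measurable_powR q)); exact: measurableT_comp.
rewrite [X in measurable X](_ : _ =
    setT `&` (fun x => `|f x| `^ q)%R @^-1` `]t, +oo[).
  by apply: mf => //; exact: measurable_itv.
by rewrite setTI; apply/seteqP; split => x /=; rewrite in_itv/= andbT.
Qed.

Let qp0 : (0 <= q / p)%R. Proof. by rewrite divr_ge0// ltW. Qed.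

Let le_poweR (a b : \bar R) : 0 <= a -> a <= b -> a `^ (q / p)%R <= b `^ (q / p)%R.
Proof.
move=> a0 ab; apply: gt0_ler_poweR => //; rewrite in_itv/= leey andbT//.
exact: le_trans ab.
Qed.

Let F_nonincreasing f s t : (0 <= s)%R -> (s <= t)%R -> F f t <= F f s.
Proof.
move=> s0 st; apply: le_poweR; first exact: (nam_ge0 mu_na).
by apply: (nam_le mu_na) => // x /=; exact: le_lt_trans.
Qed.

Let F_shift f g s t : mu_equiv mu f g -> (0 <= s)%R -> (s < t)%R ->
  F f t <= F g s.
Proof.
move=> fg s0 st; apply: le_poweR; first exact: (nam_ge0 mu_na).
have t0 : (0 <= t)%R := le_trans s0 (ltW st).
have qV0 : (0 < q^-1)%R by rewrite invr_gt0.
pose c := (t `^ q^-1 - s `^ q^-1)%R.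
have c0 : (0 < c)%R by rewrite subr_gt0; apply: gt0_ltr_powR.
have powK (a : R) : (0 <= a)%R -> ((a `^ q^-1) `^ q)%R = a.
  by move=> a0; rewrite -powRrM mulVf ?gt_eqF// powRr1.
have mc : measurable [set x | (c < `|f x - g x|)%R].
  exact: (measurable_norm_gt (f - g)%R).
rewrite -(null_additive (measurable_powR_gt g s) mc (fg _ c0)).
apply: (nam_le mu_na) => //; first exact: measurableU.
move=> x /= tf; apply/orP; apply: contraLR tf.
rewrite negb_or -!leNgt => /andP[gs fgc].
have gs' : (`|g x| <= s `^ q^-1)%R.
  rewrite -[leLHS]powRr1// -[X in (_ `^ X)%R](mulfV (lt0r_neq0 q0)) powRrM.
  by apply: ge0_ler_powR; rewrite ?nnegrE ?powR_ge0// ltW.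
rewrite -[leRHS](powK t)//; apply: ge0_ler_powR; rewrite ?nnegrE ?powR_ge0//.
  exact: ltW.
rewrite -[f x](subrK (g x)) (le_trans (ler_normD _ _))//.
by rewrite -[leRHS](subrK (s `^ q^-1)%R) lerD.
Qed.

Lemma mu_equiv_lorentz_norm (f g : {mfun T >-> R}) : mu_equiv mu f g ->
  lorentz_norm mu p q f = lorentz_norm mu p q g.
Proof.
move=> fg; rewrite /lorentz_norm; congr (_ * (_ `^ _)).
have gf := mu_equiv_sym fg.
apply/eqP; rewrite eq_le; apply/andP; split; apply: le_integral_right_shift;
  by [move=> *; exact: poweR_ge0 | exact: F_nonincreasing
     | move=> *; exact: F_shift].
Qed.

Local Open Scope quotient_scope.

Lemma lorentz_qnorm_pi (f : {mfun T >-> R}) :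
  lorentz_qnorm mu_na mu_rs p q (\pi_(mfun_mod mu_na mu_rs) f) =
    lorentz_norm mu p q f.
Proof. exact/mu_equiv_lorentz_norm/repr_pi_equiv. Qed.

End lorentz_norm_well_defined.

(* Main.v *)
Require Import Defs.
From HB Require Import structures.
From mathcomp Require Import all_boot all_order all_algebra.
From mathcomp Require Import generic_quotient.
From mathcomp Require Import all_classical all_reals all_analysis.
From mathcomp Require Import measurable_realfun ring lra.

Set Implicit Arguments.
Unset Strict Implicit.
Unset Printing Implicit Defensive.

Import Order.TTheory GRing.Theory Num.Theory.
Import numFieldNormedType.Exports.

Local Open Scope classical_set_scope.
Local Open Scope ring_scope.

(* A Cauchy sequence for the Lorentz quasi-seminorm is Cauchy in mu-measure, by
   the Chebyshev bound.  Relaxed subadditivity and property (C) then give a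
   subsequence converging uniformly outside each member of a nonincreasing
   sequence of sets A_k with mu(A_k) -> 0.  Since
   {|g - f_n| > c} \ A_k is contained in {|f_(s j) - f_n| > c/2} for j large,
   monotone autocontinuity from below yields
   mu {|g - f_n| > c} <= liminf_j mu {|f_(s j) - f_n| > c/2}, and Fatou's lemma
   on [0, +oo[ turns this into ||g - f_n|| <= 2 liminf_j ||f_(s j) - f_n||.
   The quotient inherits completeness because the norm only depends on the
   class. *)

(** * Powers and lower limits of extended reals, and dilation of integrals over the half-line *)

Section real_preliminaries.
Context {R : realType}.
Local Open Scope ereal_scope.

Lemma ler_poweR (r : R) (a b : \bar R) :
  (0 <= r)%R -> 0 <= a -> a <= b -> a `^ r <= b `^ r.
Proof.
move=> r0 a0 ab; apply: gt0_ler_poweR => //; rewrite in_itv/= leey andbT//.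
exact: le_trans ab.
Qed.

(** The sum is at most twice the larger term. This constant serves every r >= 0 at once, with no
    case split at r = 1. *)
Lemma poweR_add_le (r : R) (a b : \bar R) : (0 <= r)%R -> 0 <= a -> 0 <= b ->
  (a + b) `^ r <= (2 `^ r)%:E * (a `^ r + b `^ r).
Proof.
move=> r0; wlog ab : a b / a <= b => [hw a0 b0|a0 b0].
  have [ab|/ltW ba] := leP a b; first exact: hw.
  by rewrite addeC [X in _ * X]addeC hw.
have -> : (2 `^ r)%:E = 2%:E `^ r :> \bar R by [].
apply: (@le_trans _ _ ((2%:E * b) `^ r)).
  apply: ler_poweR => //; first exact: adde_ge0.
  by rewrite mule_natl mule2n leeD2r.
rewrite poweRM ?lee_fin// lee_wpmul2l ?poweR_ge0//.
by rewrite leeDr// poweR_ge0.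
Qed.

(** Superlevel sets of a nonincreasing function on the half-line are intervals. *)
Lemma nonincreasing_measurable_fun (F : R -> \bar R) :
  (forall s t, (0 <= s)%R -> (s <= t)%R -> F t <= F s) ->
  measurable_fun (`[0%R, +oo[ : set R) F.
Proof.
move=> ndF; apply: (measurability (@ErealGenOInfty.G R)) => [|_ [_ [r ->] <-]].
  exact: ErealGenOInfty.measurableE.
apply: is_interval_measurable => s t /= [s0 Fs] [t0 Ft] u /andP[su ut].
move: s0 Fs t0 Ft; rewrite /= !in_itv/= !andbT => s0 rs t0 rt.
have u0 := le_trans s0 su; split => //.
by apply: (lt_le_trans rt); apply: ndF.
Qed.

(** The image measure scaled by 1/a agrees with Lebesgue measure on half-open intervals, hence
    everywhere by uniqueness. *)
Lemma lebesgue_measure_dilation (a : R) (A : set R) : (0 < a)%R ->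
  measurable A ->
  pushforward lebesgue_measure ( *%R a^-1 : _ -> measurableTypeR R) A =
    a%:E * lebesgue_measure A.
Proof.
move=> a0 mA.
have aV0 : (0 < a^-1)%R by rewrite invr_gt0.
have mphi : measurable_fun setT ( *%R a^-1 : _ -> measurableTypeR R).
  exact: measurable_funM.
pose m := mscale (NngNum (ltW aV0))
  (pushforward lebesgue_measure ( *%R a^-1 : _ -> measurableTypeR R)).
rewrite (@lebesgue_measure_unique R (m mphi))//.
  rewrite -[RHS]/(a%:E * (a^-1%:E * pushforward lebesgue_measure
    ( *%R a^-1 : _ -> measurableTypeR R) A)).
  by rewrite muleA -EFinM mulfV ?gt_eqF// mul1e.
move=> _ [[x y] _ <-]; rewrite -[RHS]/(a^-1%:E * lebesgue_measure
  (( *%R a^-1 : _ -> measurableTypeR R) @^-1` `]x, y]))/=.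
have -> : *%R a^-1 @^-1` `]x, y] = `](a * x)%R, (a * y)%R]%classic.
  apply/seteqP; split => t /=; rewrite !in_itv/=;
    by rewrite ltr_pdivlMl// ler_pdivrMl.
rewrite !lebesgue_measure_itv/= !lte_fin ltr_pM2l//.
case: ifPn => _; last by rewrite mule0.
by rewrite -!EFinB -EFinM -mulrBr mulKf ?gt_eqF.
Qed.

Lemma ge0_integral_dilation (a : R) (F : R -> \bar R) : (0 < a)%R ->
  measurable_fun (`[0%R, +oo[ : set R) F -> (forall t, 0 <= F t) ->
  \int[lebesgue_measure]_(t in `[0%R, +oo[) F (a^-1 * t)%R =
  a%:E * \int[lebesgue_measure]_(t in `[0%R, +oo[) F t.
Proof.
move=> a0 mF F0.
have aV0 : (0 < a^-1)%R by rewrite invr_gt0.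
have mphi : measurable_fun setT ( *%R a^-1 : _ -> measurableTypeR R).
  exact: measurable_funM.
have {1}-> : `[0%R, +oo[%classic =
    ( *%R a^-1 : _ -> measurableTypeR R) @^-1` `[0%R, +oo[.
  by apply/seteqP; split => t /=; rewrite !in_itv/= !andbT pmulr_rge0.
rewrite -ge0_integral_pushforward//=.
rewrite -(@ge0_integral_mscale _ _ _ _ _ _ (NngNum (ltW a0)))//.
by apply: eq_measure_integral => //= A mA _; exact: lebesgue_measure_dilation.
Qed.

Lemma lty_EFinM (c : R) (a : \bar R) :
  (0 <= c)%R -> a < +oo -> c%:E * a < +oo.
Proof. by move=> c0 ay; rewrite lte_mul_pinfty ?lee_fin. Qed.

Lemma limn_einf_le (v : (\bar R)^nat) (a : \bar R) :
  (\forall n \near \oo, v n <= a) -> limn_einf v <= a.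
Proof.
move=> va; rewrite limn_einf_lim; apply: lime_le; first exact: is_cvg_einfs.
near=> n; apply: (@le_trans _ _ (v n)); last by near: n.
by apply: ereal_inf_lbound; exists n => /=.
Unshelve. all: by end_near. Qed.

Lemma limn_einf_ge (v : (\bar R)^nat) (a : \bar R) :
  (\forall n \near \oo, a <= v n) -> a <= limn_einf v.
Proof.
move=> [N _ av]; rewrite limn_einf_lim;
apply: lime_ge; first exact: is_cvg_einfs.
near=> n; apply: le_ereal_inf_tmp => _ [m /= nm <-]; apply: av => /=.
by apply: leq_trans nm; near: n; exists N.
Unshelve. all: by end_near. Qed.

(** By monotonicity of the powers r and 1/r: the r-th power of each tail infimum of v is at most the
    right-hand side L, so the tail infimum itself is at most L^(1/r). *)
Lemma poweR_limn_einf_le (r : R) (v : (\bar R)^nat) : (0 < r)%R ->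
  (forall n, 0 <= v n) -> limn_einf v `^ r <= limn_einf (fun n => v n `^ r).
Proof.
move=> r0 v0; set L := limn_einf (fun n => v n `^ r).
have L0 : 0 <= L by apply: limn_einf_ge; apply: nearW => n; exact: poweR_ge0.
have rK (a : \bar R) : 0 <= a -> (a `^ r) `^ r^-1 = a.
  by move=> a0; rewrite -poweRrM mulfV ?gt_eqF// poweRe1.
have -> : L = (L `^ r^-1) `^ r by rewrite -poweRrM mulVf ?gt_eqF// poweRe1.
apply: ler_poweR; first exact: ltW.
  by apply: limn_einf_ge; exact: nearW.
rewrite limn_einf_lim; apply: lime_le; first exact: is_cvg_einfs.
apply: nearW => k.
have vk0 : 0 <= einfs v k by apply: le_ereal_inf_tmp => _ [m _ <-].
rewrite -(rK (einfs v k))//; apply: ler_poweR; first by rewrite invr_ge0 ltW.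
  exact: poweR_ge0.
apply: limn_einf_ge; exists k => // n /= kn; apply: ler_poweR => //.
  exact: ltW.
by apply: ereal_inf_lbound; exists n.
Qed.

Lemma cvge_to0 (v : (\bar R)^nat) : (forall n, 0 <= v n) ->
  (forall e : R, (0 < e)%R -> \forall n \near \oo, v n <= e%:E) ->
  v @ \oo --> (0 : \bar R).
Proof.
move=> v0 ve; apply: limn_esup_le_cvg => //.
apply/lee_addgt0Pr => e /ve[N _ vN]; rewrite add0e limn_esup_lim.
apply: lime_le; first exact: is_cvg_esups.
near=> n; apply: ge_ereal_sup => _ [m /= nm <-]; apply: vN => /=.
by apply: leq_trans nm; near: n; exists N.
Unshelve. all: by end_near. Qed.

End real_preliminaries.

(** * The Lorentz functional: homogeneity, Chebyshev bound, quasi-triangle inequality and Fatou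
    property *)

Section lorentz_quasi_seminorm.
Context d (T : measurableType d) (R : realType) (mu : set T -> \bar R).
Hypothesis mu_na : nonadditive_measure mu.
Variables p q : R.
Hypotheses (p0 : 0 < p) (q0 : 0 < q).
Implicit Types f g : {mfun T >-> R}.
Local Open Scope ereal_scope.

Let level f (t : R) := mu [set x | (t < `|f x| `^ q)%R] `^ (q / p)%R.

Let ch f := \int[lebesgue_measure]_(t in `[0%R, +oo[) level f t.

Let lorentz_normE f :
  lorentz_norm mu p q f = ((p / q) `^ q^-1)%:E * ch f `^ q^-1.
Proof. by []. Qed.

Let qp0 : (0 <= q / p)%R. Proof. by rewrite divr_ge0// ltW. Qed.
Let pq_gt0 : (0 < (p / q) `^ q^-1)%R.
Proof. by rewrite powR_gt0// divr_gt0. Qed.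

Let powRqK (a : R) : (0 <= a)%R -> ((a `^ q) `^ q^-1 = a)%R.
Proof. by move=> a0; rewrite -powRrM mulfV ?gt_eqF// powRr1. Qed.

Let powRqVK (a : R) : (0 <= a)%R -> ((a `^ q^-1) `^ q = a)%R.
Proof. by move=> a0; rewrite -powRrM mulVf ?gt_eqF// powRr1. Qed.

Lemma measurable_norm_powR_gt f (t : R) :
  measurable [set x | (t < `|f x| `^ q)%R].
Proof.
have mf : measurable_fun setT (fun x => `|f x| `^ q)%R.
  by apply: (measurableT_comp (measurable_powR q)); exact: measurableT_comp.
rewrite [X in measurable X](_ : _ =
    setT `&` (fun x => `|f x| `^ q)%R @^-1` `]t, +oo[).
  by apply: mf => //; exact: measurable_itv.
by rewrite setTI; apply/seteqP; split => x /=; rewrite in_itv/= andbT.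
Qed.

Let mu_level_ge0 f t : 0 <= mu [set x | (t < `|f x| `^ q)%R].
Proof. by apply: (nam_ge0 mu_na); exact: measurable_norm_powR_gt. Qed.

Lemma norm_powR_gtE f (c : R) : (0 <= c)%R ->
  [set x | (c `^ q < `|f x| `^ q)%R] = [set x | (c < `|f x|)%R].
Proof.
move=> c0; apply/seteqP; split => x /=; last by apply: gt0_ltr_powR.
apply: contraLR; rewrite -!leNgt => fc.
by apply: ge0_ler_powR; rewrite ?nnegrE// ltW.
Qed.

Let level_ge0 f t : 0 <= level f t. Proof. exact: poweR_ge0. Qed.

Let level_nonincreasing f s t : (0 <= s)%R -> (s <= t)%R ->
  level f t <= level f s.
Proof.
move=> s0 st; apply: ler_poweR => //.
apply: (nam_le mu_na); [exact: measurable_norm_powR_gt..|].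
by move=> x /=; exact: le_lt_trans.
Qed.

Let measurable_level f : measurable_fun (`[0%R, +oo[ : set R) (level f).
Proof.
by apply: nonincreasing_measurable_fun => s t; exact: level_nonincreasing.
Qed.

Let measurable_level_dilation f a : (0 < a)%R ->
  measurable_fun (`[0%R, +oo[ : set R) (fun t => level f (a * t)%R).
Proof.
move=> a0; apply: nonincreasing_measurable_fun => s t s0 st.
by apply: level_nonincreasing; rewrite ?ler_pM2l// mulr_ge0// ltW.
Qed.

Let ch_ge0 f : 0 <= ch f. Proof. exact: integral_ge0. Qed.

Lemma lorentz_norm_ge0 f : 0 <= lorentz_norm mu p q f.
Proof. by rewrite lorentz_normE mule_ge0 ?poweR_ge0// lee_fin ltW. Qed.

(** For c nonzero, the level of c f at t is the level of f at t / |c|^q, so dilation brings out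
    |c|^q and the q-th root turns it into |c|. The case c = 0, where this scaling degenerates, is
    computed directly. *)
Lemma lorentz_normZ (c : R) f :
  lorentz_norm mu p q (c *: f)%R = `|c|%:E * lorentz_norm mu p q f.
Proof.
have qV0 : (q^-1 != 0)%R by rewrite invr_eq0 gt_eqF.
have qp_neq0 : (q / p != 0)%R by rewrite mulf_neq0 ?invr_eq0 ?gt_eqF.
have [->|c_neq0] := eqVneq c 0%R.
  rewrite scale0r normr0 mul0e lorentz_normE.
  suff -> : ch 0%R = 0 by rewrite poweR0r// mule0.
  rewrite /ch -[RHS](@integral0 _ _ _ (@lebesgue_measure R) `[0%R, +oo[).
  apply: eq_integral => t; rewrite inE/= in_itv/= andbT => t0.
  rewrite /level (_ : [set x | _] = set0) ?(nam_set0 mu_na) ?poweR0r//.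
  by apply/seteqP; split => x //=; rewrite normr0 powR0 ?gt_eqF// ltNge t0.
have c0 : (0 < `|c| `^ q)%R by rewrite powR_gt0// normr_gt0.
rewrite !lorentz_normE.
have -> : ch (c *: f)%R = (`|c| `^ q)%:E * ch f.
  transitivity (\int[lebesgue_measure]_(t in `[0%R, +oo[)
      level f ((`|c| `^ q)^-1 * t)%R); last first.
    exact: (ge0_integral_dilation c0 (measurable_level f)).
  apply: eq_integral => t _; congr (mu _ `^ _).
  by apply/seteqP; split => x /=; rewrite normrM powRM// ltr_pdivrMl.
by rewrite poweRM ?lee_fin ?powR_ge0// poweR_EFin powRqK// muleCA.
Qed.

(* Since [level f] is nonincreasing, its integral is at least [t * level f t];
   take [t = c `^ q]. *)
Lemma lorentz_norm_chebyshev f (c : R) : (0 <= c)%R ->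
  ((p / q) `^ q^-1 * c)%:E * mu [set x | (c < `|f x|)%R] `^ p^-1 <=
  lorentz_norm mu p q f.
Proof.
move=> c0; rewrite lorentz_normE EFinM -muleA lee_pmul2l//.
have cq0 : (0 <= c `^ q)%R by exact: powR_ge0.
have -> : c%:E * mu [set x | (c < `|f x|)%R] `^ p^-1 =
    ((c `^ q)%:E * level f (c `^ q)) `^ q^-1.
  rewrite poweRM// poweR_EFin powRqK// /level norm_powR_gtE//.
  by rewrite -poweRrM mulrAC mulfV ?mul1r ?gt_eqF.
apply: ler_poweR; [by rewrite invr_ge0 ltW|exact: mule_ge0|].
have sub : `[0%R, (c `^ q)%R[ `<=` (`[0%R, +oo[ : set R).
  by move=> t /=; rewrite !in_itv/= andbT => /andP[].
apply: (@le_trans _ _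
  (\int[lebesgue_measure]_(t in `[0%R, (c `^ q)%R[) level f t)).
  have -> : (c `^ q)%:E * level f (c `^ q) =
      \int[lebesgue_measure]_(t in `[0%R, (c `^ q)%R[) level f (c `^ q).
    rewrite integral_cst// muleC; congr (_ * _).
    rewrite [RHS]lebesgue_measure_itv/= lte_fin oppr0 adde0.
    (* The length formula tests 0 < c^q; when the test fails, c^q is 0, the length of the empty
       interval. *)
    case: ifPn => //; rewrite -leNgt => cq_le0.
    by congr EFin; apply/eqP; rewrite eq_le cq_le0.
  apply: ge0_le_integral => //.
  - exact: measurable_funS (measurable_level f).
  - move=> t /=; rewrite in_itv/= => /andP[t0 /ltW].
    exact: level_nonincreasing.
by apply: ge0_subset_integral => //; exact: measurable_level.
Qed.

(** Chebyshev's bound at each c > 0. This is what makes the norm definite on classes. *)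
Lemma lorentz_norm_eq0 f : lorentz_norm mu p q f = 0 -> mu_equiv mu f 0%R.
Proof.
move=> f0 c c0; rewrite (_ : [set x | _] = [set x | (c < `|f x|)%R]); last first.
  by apply/seteqP; split => x /=; rewrite subr0.
have := lorentz_norm_chebyshev f (ltW c0); rewrite f0.
rewrite pmule_rle0 ?lte_fin ?mulr_gt0// => m0.
have mm : 0 <= mu [set x | (c < `|f x|)%R].
  by apply: (nam_ge0 mu_na); exact: measurable_norm_gt.
apply: (@poweR_eq0_eq0 _ _ p^-1%R) => //.
by apply/eqP; rewrite eq_le m0 poweR_ge0.
Qed.

(** The union is that of A and the disjoint set B \ A, so the constant for disjoint sets serves for
    all pairs. *)
Lemma relaxed_subadditive_setU (K : R) (A B : set T) : (0 <= K)%R ->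
  (forall A B, measurable A -> measurable B ->
     A `&` B = set0 -> mu (A `|` B) <= K%:E * (mu A + mu B)) ->
  measurable A -> measurable B -> mu (A `|` B) <= K%:E * (mu A + mu B).
Proof.
move=> K0 muK mA mB.
have mD : measurable (B `\` A) by exact: measurableD.
have -> : A `|` B = A `|` (B `\` A) by rewrite setDE setUIr setUCr setIT.
apply: (le_trans (muK _ _ mA mD _)); first by rewrite setDE setICA setICr setI0.
rewrite lee_wpmul2l ?lee_fin// leeD2l//.
by apply: (nam_le mu_na) => //; exact: subDsetl.
Qed.

(** If |f + g|^q > t, then |f|^q or |g|^q exceeds t / 2^q. The levels of f + g are thus controlled
    by dilated levels of f and g; it remains to integrate and take the q-th root. *)
Lemma lorentz_normD : relaxed_subadditive mu -> exists2 K : R, (1 <= K)%R &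
  forall f g, lorentz_norm mu p q (f + g)%R <=
    K%:E * (lorentz_norm mu p q f + lorentz_norm mu p q g).
Proof.
move=> [K K1 muK]; have K0 : (0 <= K)%R by exact: le_trans K1.
pose r := (q / p)%R; pose s := q^-1%R.
have s0 : (0 <= s)%R by rewrite invr_ge0 ltW.
have two_q : (0 < 2 `^ q :> R)%R by exact: powR_gt0.
have powR_ge1 (a b : R) : (1 <= a)%R -> (0 <= b)%R -> (1 <= a `^ b)%R.
  by move=> a1 b0; rewrite -[leLHS](powRr0 a) ler_powR.
have mulr_ge1 (a b : R) : (1 <= a)%R -> (1 <= b)%R -> (1 <= a * b)%R.
  by move=> a1 b1; rewrite -[leLHS]mulr1 ler_pM.
(* K^r is the constant of relaxed subadditivity raised to the power r = q/p, and 2^r comes from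
   [poweR_add_le]. *)
pose M := (K `^ r * 2 `^ r)%R.
have M1 : (1 <= M)%R by rewrite mulr_ge1// powR_ge1// ler1n.
have M0 : (0 <= M)%R by exact: le_trans M1.
(* Inside the root, 2^q is the dilation factor; the outer 2^s is the cost of splitting the s-th
   power of a sum, with s = 1/q. *)
exists ((M * 2 `^ q) `^ s * 2 `^ s)%R.
  by rewrite mulr_ge1 ?powR_ge1 ?mulr_ge1 ?powR_ge1 ?ler1n// ltW.
move=> f g; rewrite !lorentz_normE -ge0_muleDr ?poweR_ge0// muleCA.
rewrite lee_pmul2l//.
pose u := ((2 `^ q)^-1)%R.
have u0 : (0 < u)%R by rewrite invr_gt0.
have lvl t : (0 <= t)%R ->
    level (f + g)%R t <= M%:E * (level f (u * t)%R + level g (u * t)%R).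
  move=> t0.
  have sub : [set x | (t < `|(f + g)%R x| `^ q)%R] `<=`
      [set x | (u * t < `|f x| `^ q)%R] `|` [set x | (u * t < `|g x| `^ q)%R].
    move=> x /= tx; apply/orP; apply: contraLR tx.
    rewrite negb_or -!leNgt !ler_pdivlMl// => /andP[fx gx].
    apply: (@le_trans _ _ ((2 * Num.max `|f x| `|g x|) `^ q)%R).
      rewrite ge0_ler_powR ?nnegrE ?(ltW q0) ?mulr_ge0 ?le_max ?normr_ge0//.
      rewrite (le_trans (ler_normD _ _))// mulr_natl mulr2n lerD//;
        by rewrite le_max lexx ?orbT.
    by rewrite powRM ?le_max ?normr_ge0//; case: (leP `|f x|%R `|g x|%R).
  have mf := measurable_norm_powR_gt f (u * t).
  have mg := measurable_norm_powR_gt g (u * t).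
  have mfg := measurable_norm_powR_gt (f + g)%R t.
  apply: (@le_trans _ _ ((K%:E * (mu [set x | (u * t < `|f x| `^ q)%R] +
      mu [set x | (u * t < `|g x| `^ q)%R])) `^ r)).
    apply: ler_poweR => //.
    apply: le_trans (relaxed_subadditive_setU K0 muK mf mg).
    by apply: (nam_le mu_na) => //; exact: measurableU.
  rewrite poweRM ?lee_fin ?adde_ge0 ?mu_level_ge0// poweR_EFin EFinM -muleA.
  rewrite lee_wpmul2l ?lee_fin ?powR_ge0//.
  by exact: poweR_add_le.
have ch_le : ch (f + g)%R <= (M * 2 `^ q)%:E * (ch f + ch g).
  apply: (@le_trans _ _ (\int[lebesgue_measure]_(t in `[0%R, +oo[)
      (M%:E * (level f (u * t)%R + level g (u * t)%R)))).
    apply: ge0_le_integral => //; first exact: measurable_level.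
      apply: measurable_funeM; apply: emeasurable_funD;
        exact: measurable_level_dilation.
    by move=> t /=; rewrite in_itv/= andbT; exact: lvl.
  rewrite ge0_integralZl_EFin//; last 2 first.
  - by move=> t _; rewrite adde_ge0.
  - by apply: emeasurable_funD; exact: measurable_level_dilation.
  rewrite ge0_integralD//; [|exact: measurable_level_dilation..].
  by rewrite !ge0_integral_dilation// -ge0_muleDr ?ch_ge0// muleA -EFinM.
have MM0 : (0 <= M * 2 `^ q)%R by rewrite mulr_ge0// ltW.
apply: (@le_trans _ _ (((M * 2 `^ q)%:E * (ch f + ch g)) `^ s)).
  by apply: ler_poweR.
have chfg0 : 0 <= ch f + ch g by apply: adde_ge0; exact: ch_ge0.
rewrite poweRM ?lee_fin// poweR_EFin EFinM -muleA.
rewrite lee_wpmul2l ?lee_fin ?powR_ge0//.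
by apply: poweR_add_le => //; exact: ch_ge0.
Qed.

(** Fatou's lemma is applied to the levels. Halving the threshold is a dilation of t by 2^-q, which
    costs 2^q in the integral, hence the factor 2 in the norm. *)
Lemma lorentz_norm_fatou g (g_ : nat -> {mfun T >-> R}) (e : R) : (0 <= e)%R ->
  (forall s : R, (0 < s)%R -> mu [set x | (s < `|g x|)%R] <=
     limn_einf (fun n => mu [set x | (s / 2 < `|g_ n x|)%R])) ->
  (\forall n \near \oo, lorentz_norm mu p q (g_ n) <= e%:E) ->
  lorentz_norm mu p q g <= (2 * e)%:E.
Proof.
move=> e0 gle Ne; have := pq_gt0; set C := ((p / q) `^ q^-1)%R => C0.
have two_q : (0 < 2 `^ q :> R)%R by exact: powR_gt0.
pose u := ((2 `^ q)^-1)%R.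
have u0 : (0 < u)%R by rewrite invr_gt0.
have half_powR : (2^-1 `^ q = u)%R.
  apply: (mulfI (lt0r_neq0 two_q)).
  by rewrite -powRM// !mulfV ?gt_eqF// powR1.
have eC0 : (0 <= e / C)%R by rewrite divr_ge0// ltW.
have ch_le (h : {mfun T >-> R}) :
    lorentz_norm mu p q h <= e%:E -> ch h <= ((e / C) `^ q)%:E.
  rewrite lorentz_normE -lee_pdivlMl// -EFinM mulrC => he.
  have -> : ch h = (ch h `^ q^-1) `^ q.
    by rewrite -poweRrM mulVf ?gt_eqF// poweRe1.
  by rewrite -poweR_EFin; apply: ler_poweR => //; [exact: ltW|exact: poweR_ge0].
have lvl t : (0 < t)%R ->
    level g t <= limn_einf (fun n => level (g_ n) (u * t)%R).
  move=> t0; have s0 : (0 < t `^ q^-1)%R by exact: powR_gt0.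
  have := gle _ s0; rewrite -norm_powR_gtE ?powRqVK ?(ltW s0) ?(ltW t0)// => gt.
  apply: (@le_trans _ _ (limn_einf (fun n =>
      mu [set x | (t `^ q^-1 / 2 < `|g_ n x|)%R]) `^ (q / p)%R)).
    exact: ler_poweR.
  (* The threshold t^(1/q) / 2 for |g_n| is the threshold u t for its q-th power. *)
  under [X in _ <= limn_einf X]eq_fun => n.
    rewrite /level (_ : u * t = (t `^ q^-1 / 2) `^ q)%R; last first.
      by rewrite powRM// ?(ltW s0)// powRqVK ?(ltW t0)// half_powR mulrC.
    rewrite norm_powR_gtE ?divr_ge0 ?(ltW s0)//; over.
  apply: poweR_limn_einf_le; first by rewrite divr_gt0.
  by move=> n; apply: (nam_ge0 mu_na); exact: measurable_norm_gt.
have chg : ch g <= (2 `^ q * (e / C) `^ q)%:E.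
  (* [lvl] is stated for t > 0, so the integrals are moved to the open half-line, which differs by
     one point. *)
  have sub : `]0%R, +oo[ `<=` (`[0%R, +oo[ : set R).
    by move=> t /=; rewrite !in_itv/= !andbT => /ltW.
  have mg n :
      measurable_fun (`]0%R, +oo[ : set R) (fun t => level (g_ n) (u * t)%R).
    exact: measurable_funS (measurable_level_dilation (g_ n) u0).
  have mg0 : measurable_fun (`]0%R, +oo[ : set R) (level g).
    exact: measurable_funS (measurable_level g).
  rewrite /ch -integral_itv_obnd_cbnd//.
  apply: (@le_trans _ _ (\int[lebesgue_measure]_(t in `]0%R, +oo[)
      limn_einf (fun n => level (g_ n) (u * t)%R))).
    apply: ge0_le_integral => //.
    - rewrite /limn_einf; apply: measurableT_comp => //.
      apply: measurable_fun_limn_esup => n.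
      by apply: measurableT_comp => //; exact: mg.
    - by move=> t /=; rewrite in_itv/= andbT; exact: lvl.
  apply: (le_trans (@fatou _ _ _ lebesgue_measure `]0%R, +oo[ _
    (fun n t => level (g_ n) (u * t)%R) mg _)) => //.
  apply: limn_einf_le; apply: filterS Ne => n /ch_le.
  rewrite integral_itv_obnd_cbnd// ge0_integral_dilation// EFinM => gn.
  by rewrite lee_pmul2l.
rewrite lorentz_normE -lee_pdivlMl// -EFinM.
apply: (@le_trans _ _ (((2 * (e / C)) `^ q)%:E `^ q^-1)).
  apply: ler_poweR => //; first by rewrite invr_ge0 ltW.
  by rewrite powRM.
rewrite poweR_EFin powRqK ?mulr_ge0 ?invr_ge0 ?(ltW C0)// lee_fin -/C.
by rewrite mulrA mulrC.
Qed.

End lorentz_quasi_seminorm.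

(** * Almost uniform limits of subsequences of sequences that are Cauchy in measure *)

Lemma cvg_geometric_dist (R : realType) (x : nat -> R) (k : nat) :
  (forall i, (k <= i)%N -> `|x i.+1 - x i| <= 2^-1 ^+ i) ->
  cvgn x /\ forall i, (k <= i)%N -> `|limn x - x i| <= 2 * 2^-1 ^+ i.
Proof.
(* [b i] is the sum of the geometric series from index i on, so it bounds all remaining increments
   together. *)
move=> xk; pose b (i : nat) : R := 2 * 2^-1 ^+ i.
have bS i : b i = 2^-1 ^+ i + b i.+1.
  by rewrite /b exprS mulrA mulfV// mul1r -mulr2n mulr_natl.
have b0 i : 0 < b i by rewrite mulr_gt0// exprn_gt0.
(* Subtracting b (i + m) makes the induction telescope through [bS]. *)
have dist i m : (k <= i)%N -> `|x (i + m)%N - x i| <= b i - b (i + m)%N.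
  move=> ki; elim: m => [|m IHm]; first by rewrite addn0 !subrr normr0.
  rewrite addnS -(subrK (x (i + m)%N) (x (i + m).+1)) -addrA.
  rewrite (le_trans (ler_normD _ _))//.
  have := lerD (xk (i + m)%N (leq_trans ki (leq_addr _ _))) IHm.
  by have := bS (i + m)%N; lra.
have ball_i i n : (k <= i)%N -> (i <= n)%N -> `|x n - x i| <= b i.
  move=> ki /subnKC <-; apply: (le_trans (dist _ _ ki)).
  by rewrite gerBl ltW.
have cx : cvgn x.
  apply/cauchy_cvgP/cauchy_exP => e e0.
  have b_cvg : b @ \oo --> (0 : R).
    rewrite -(mulr0 2); apply: cvgMr; apply: cvg_expr.
    by rewrite ger0_norm// invf_lt1// ltr1n.
  near \oo => i.
  have ki : (k <= i)%N by near: i; exists k.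
  have bie : b i < e by near: i; exact: (cvgr_lt _ b_cvg).
  exists (x i); exists i => // n /= ni.
  by rewrite /ball/= distrC (le_lt_trans (ball_i _ _ ki ni)).
split=> // i ki; rewrite ler_distl; apply/andP; split.
  apply: limr_ge => //; exists i => // n /= ni.
  by have := ball_i _ _ ki ni; rewrite ler_distl => /andP[].
apply: limr_le => //; exists i => // n /= ni.
by have := ball_i _ _ ki ni; rewrite ler_distl => /andP[].
Unshelve. all: by end_near. Qed.

Section almost_uniform_convergence.
Context d (T : measurableType d) (R : realType) (mu : set T -> \bar R).
Hypotheses (mu_na : nonadditive_measure mu) (mu_rs : relaxed_subadditive mu).
Local Open Scope ereal_scope.

(* With [a_k = (2K)^-k] one has [a_k = K (a_k.+1 + a_k.+1)], so that sets of
   measure at most [a_k.+1] have finite unions from [k] on of measure at most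
   [a_k]. *)
Lemma tail_bigcup_cvg0 : property_C mu -> exists2 eta : nat -> R,
  (forall k, (0 < eta k)%R) &
  forall E : nat -> set T, (forall n, measurable (E n)) ->
    (forall k, mu (E k) <= (eta k)%:E) ->
    (fun k => mu (\bigcup_(n >= k) E n)) @ \oo --> (0 : \bar R).
Proof.
move=> mu_C; have [K K1 muK] := mu_rs.
have K0 : (0 < K)%R by exact: lt_le_trans K1.
pose a (k : nat) : R := ((2 * K)^-1 ^+ k)%R.
have a0 k : (0 < a k)%R by rewrite exprn_gt0// invr_gt0 mulr_gt0.
have aS k : (K * (a k.+1 + a k.+1) = a k)%R.
  by rewrite /a exprS; set y := (_ ^+ k)%R; field; rewrite gt_eqF.
exists (fun k => a k.+1) => // E mE Ea; apply: mu_C => //.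
pose U k l := \bigcup_(n in [set n | (k <= n <= k + l)%N]) E n.
have mU k l : measurable (U k l) by exact: bigcup_measurable.
(* Induction on the length l for all starting points k at once, since peeling off E k leaves a
   window that starts at k + 1. *)
have Ua l : forall k, mu (U k l) <= (a k)%:E.
  elim: l => [|l IHl] k.
    have -> : U k 0%N = E k.
      apply/seteqP; split => [x [n /= nk En]|x Ek]; last first.
        by exists k => //=; rewrite addn0 leqnn.
      by move: nk En; rewrite addn0 -eqn_leq => /eqP <-.
    apply: le_trans (Ea k) _; rewrite lee_fin -(aS k).
    by rewrite -[leLHS]mul1r ler_pM ?lerDl ?(ltW (a0 _)).
  have sub : U k l.+1 `<=` E k `|` U k.+1 l.
    move=> x [n /= /andP[kn nl] En].
    move: kn; rewrite leq_eqVlt => /predU1P[kn|kn]; first by left; rewrite kn.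
    by right; exists n => //=; rewrite kn addSnnS.
  apply: (@le_trans _ _ (mu (E k `|` U k.+1 l))).
    by apply: (nam_le mu_na) => //; exact: measurableU.
  apply: (le_trans (relaxed_subadditive_setU mu_na (ltW K0) muK _ _)) => //.
  by rewrite -(aS k) EFinM lee_pmul2l// EFinD leeD.
apply: cvge_to0 => [k|e e0].
  apply: (@le_trans _ _ (mu (U k 0%N))); first exact: (nam_ge0 mu_na).
  by apply: ereal_sup_ubound; exists 0%N.
have a_cvg : a @ \oo --> (0%R : R).
  apply: cvg_expr; rewrite ger0_norm ?invr_ge0 ?mulr_ge0 ?ltW//.
  by rewrite invf_lt1 ?mulr_gt0//; lra.
have : \forall k \near \oo, (a k <= e)%R by exact: (cvgr_le _ a_cvg).
apply: filterS => k ake; apply: ge_ereal_sup => _ [l _ <-].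
by apply: le_trans (Ua l k) _; rewrite lee_fin.
Qed.

(** The indices make the sets where consecutive terms differ by more than 2^-k small enough for
    [tail_bigcup_cvg0]; outside the k-th tail union the increments are geometric. *)
Lemma cauchy_in_measure_almost_uniform (f : nat -> {mfun T >-> R}) :
  property_C mu ->
  (forall c e : R, (0 < c)%R -> (0 < e)%R -> exists n0, forall m n,
     (n0 <= m)%N -> (n0 <= n)%N ->
     mu [set x | (c < `|f m x - f n x|)%R] <= e%:E) ->
  exists (s : nat -> nat) (g : {mfun T >-> R}) (A : nat -> set T),
    [/\ (forall j, (j <= s j)%N), (forall k, measurable (A k)),
        (forall k, A k.+1 `<=` A k),
        (fun k => mu (A k)) @ \oo --> (0 : \bar R) &
        forall k x, ~ A k x -> forall i, (k <= i)%N ->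
          (`|g x - f (s i) x| <= 2 * 2^-1 ^+ i)%R].
Proof.
move=> /tail_bigcup_cvg0[eta eta0 tail] fc.
have fc' k : {n0 | forall m n, (n0 <= m)%N -> (n0 <= n)%N ->
    mu [set x | (2^-1 ^+ k < `|f m x - f n x|)%R] <= (eta k)%:E}.
  by apply/cid/fc => //; rewrite exprn_gt0.
pose N k := sval (fc' k).
(* Summing all N i up to k makes s nondecreasing with s k >= N k, and the summand k gives s k >=
   k. *)
pose s k := (k + \sum_(i < k.+1) N i)%N.
have sN k : (N k <= s k)%N.
  by rewrite /s big_ord_recr/= addnA leq_addl.
have sS k : (s k <= s k.+1)%N.
  by rewrite /s [in leqRHS]big_ord_recr/= leq_add// leq_addr.
pose E k := [set x | (2^-1 ^+ k < `|f (s k.+1) x - f (s k) x|)%R].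
have mE k : measurable (E k)
  by exact: (measurable_norm_gt (f (s k.+1) - f (s k))%R).
have muE k : mu (E k) <= (eta k)%:E.
  by apply: (svalP (fc' k)); [exact: leq_trans (sN k) (sS k)|exact: sN].
pose A k := \bigcup_(n >= k) E n.
have mA k : measurable (A k) by exact: bigcup_measurable.
have fA k x : ~ A k x -> forall i, (k <= i)%N ->
    (`|f (s i.+1) x - f (s i) x| <= 2^-1 ^+ i)%R.
  by move=> Akx i ki; rewrite leNgt; apply/negP => Ei; apply: Akx; exists i.
(* D collects the points outside some A k. Cutting f (s j) off to D makes the sequence converge at
   every point, to 0 off D, so the limit is measurable. *)
pose D := ~` \bigcap_k A k.
have mD : measurable D by apply: measurableC; exact: bigcap_measurable.
pose h j x := (f (s j) x * \1_D x)%R.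
pose g0 x := limn (h ^~ x).
have hD j x : D x -> h j x = f (s j) x.
  by move=> Dx; rewrite /h indicE mem_set// mulr1.
have AD k x : ~ A k x -> D x by move=> Akx Ax; apply: Akx; exact: Ax.
have mg0 : measurable_fun setT g0.
  apply: (@measurable_fun_cvg _ _ _ setT h) => [j|x _].
    by apply: measurable_funM => //; exact: measurable_indic.
  have [Dx|Dx] := pselect (D x); last first.
    have h0 : h ^~ x = cst 0%R.
      by apply/funext => j; rewrite /h indicE memNset// mulr0.
    by rewrite /g0 h0; exact: is_cvg_cst.
  have /existsNP[k] : ~ (forall k, A k x)
    by move=> Ax; apply: Dx => k _; exact: Ax.
  move=> /fA/cvg_geometric_dist[].
  by under eq_fun do rewrite -(hD _ _ Dx).
pose g : {mfun T >-> R} := HB.pack g0 (isMeasurableFun.Build _ _ _ _ g0 mg0).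
exists s, g, A; split => //.
- by move=> j; rewrite leq_addr.
- by move=> k x [n /= kn En]; exists n => //=; exact: ltnW.
- exact: tail.
- move=> k x Akx i ki.
  have [_ /(_ i ki)] := cvg_geometric_dist (fA _ _ Akx).
  by under eq_fun do rewrite -(hD _ _ (AD _ _ Akx)).
Qed.

Lemma almost_uniform_norm_gt_le (f : nat -> {mfun T >-> R})
    (g f0 : {mfun T >-> R}) (A : nat -> set T) :
  monotone_autocontinuous_from_below mu ->
  (forall k, measurable (A k)) -> (forall k, A k.+1 `<=` A k) ->
  (fun k => mu (A k)) @ \oo --> (0 : \bar R) ->
  (forall k x, ~ A k x -> forall i, (k <= i)%N ->
     (`|g x - f i x| <= 2 * 2^-1 ^+ i)%R) ->
  forall c : R, (0 < c)%R ->
    mu [set x | (c < `|(g - f0)%R x|)%R] <=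
    limn_einf (fun j => mu [set x | (c / 2 < `|(f j - f0)%R x|)%R]).
Proof.
move=> mu_ac mA ndA A0 gA c c0.
have mG := measurable_norm_gt (g - f0)%R c.
have acA := mu_ac _ _ mG mA ndA A0.
(* Autocontinuity turns the left side into the limit of the measures of {|g - f0| > c} \ A k, so it
   is enough to bound each of these. *)
rewrite -(cvg_lim _ acA)//; apply: lime_le; first exact: (cvgP _ acA).
have b_cvg : (fun i : nat => 2 * 2^-1 ^+ i)%R @ \oo --> (0%R : R).
  rewrite -(mulr0 2%R); apply: cvgMr; apply: cvg_expr.
  by rewrite ger0_norm// invf_lt1// ltr1n.
have c20 : (0 < c / 2)%R by rewrite divr_gt0.
have [N _ bN] : \forall i \near \oo, (2 * 2^-1 ^+ i <= c / 2)%R.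
  exact: (cvgr_le _ b_cvg).
(* Past N the uniform error is at most c/2, and past k it is valid outside A k; there |g - f0| > c
   forces |f j - f0| > c/2. *)
apply: nearW => k; apply: limn_einf_ge; exists (maxn N k) => // j /=.
rewrite geq_max => /andP[Nj kj]; apply: (nam_le mu_na).
- by apply: measurableD.
- exact: measurable_norm_gt.
move=> x /= [cx Akx].
have gfj : (`|g x - f j x| <= c / 2)%R.
  exact: le_trans (gA _ _ Akx _ kj) (bN _ Nj).
rewrite -[X in is_true X]/(c / 2 < `|f j x - f0 x|)%R ltNge; apply/negP => fj.
have : (c < `|g x - f0 x|)%R := cx; apply/negP; rewrite -leNgt.
rewrite -(subrK (f j x) (g x)) -addrA [leRHS]splitr.
by rewrite (le_trans (ler_normD _ _))// lerD.
Qed.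

End almost_uniform_convergence.

(** * Completeness of the function space and of its quotient *)

Section lorentz_complete.
Context d (T : measurableType d) (R : realType) (mu : set T -> \bar R).
Hypotheses (mu_na : nonadditive_measure mu) (mu_rs : relaxed_subadditive mu).
Variables p q : R.
Hypotheses (p0 : 0 < p) (q0 : 0 < q).
Local Open Scope ereal_scope.

Let N (f : {mfun T >-> R}) := lorentz_norm mu p q f.

Lemma lorentz_fun_quasi_seminorm_on : quasi_seminorm_on (lorentz_fun mu p q) N.
Proof.
have [K K1 NK] := lorentz_normD mu_na p0 q0 mu_rs.
split.
- have := lorentz_normZ mu_na p0 q0 0%R 0%R.
  by rewrite scale0r normr0 mul0e /lorentz_fun/= => ->.
- move=> f g /= Nf Ng; apply: (le_lt_trans (NK f g)).
  exact: lty_EFinM (le_trans ler01 K1) (lte_add_pinfty Nf Ng).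
- move=> c f Nf; rewrite /lorentz_fun /mkset lorentz_normZ//.
  exact: lty_EFinM (normr_ge0 c) Nf.
- by move=> f _; exact: lorentz_norm_ge0.
- by [].
- by move=> c f _; exact: lorentz_normZ.
- by exists K => // f g _ _; exact: NK.
Qed.

Lemma lorentz_norm_cauchy_in_measure (f : nat -> {mfun T >-> R}) :
  cauchy_wrt N f -> forall c e : R, (0 < c)%R -> (0 < e)%R ->
  exists n0, forall m n, (n0 <= m)%N -> (n0 <= n)%N ->
    mu [set x | (c < `|f m x - f n x|)%R] <= e%:E.
Proof.
move=> cf c e c0 e0.
have C0 : (0 < (p / q) `^ q^-1)%R by rewrite powR_gt0// divr_gt0.
(* This tolerance is the Chebyshev lower bound for the norm when the measure is at least e. *)
have [|n0 fn0] := cf ((p / q) `^ q^-1 * c * e `^ p^-1)%R.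
  by rewrite !mulr_gt0// powR_gt0.
exists n0 => m n mn0 nn0; rewrite leNgt; apply/negP => /ltW emu.
have := fn0 _ _ mn0 nn0; apply/negP; rewrite -leNgt.
apply: le_trans (lorentz_norm_chebyshev mu_na p0 q0 (f m - f n)%R (ltW c0)).
rewrite EFinM lee_pmul2l ?lte_fin ?mulr_gt0// -poweR_EFin.
by apply: ler_poweR => //; rewrite ?invr_ge0 ?lee_fin ltW.
Qed.

Lemma lorentz_fun_complete :
  monotone_autocontinuous_from_below mu -> property_C mu ->
  complete_wrt (lorentz_fun mu p q) N.
Proof.
move=> mu_ac mu_C f Sf cf.
have [s [g [A [sj mA ndA A0 gA]]]] := cauchy_in_measure_almost_uniform
  mu_na mu_rs mu_C (lorentz_norm_cauchy_in_measure cf).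
(* Here n is fixed while j tends to infinity; since s j >= j, the Cauchy index n0 serves for both n
   and s j. *)
have Ng (e : R) : (0 < e)%R -> \forall n \near \oo, N (g - f n)%R <= (2 * e)%:E.
  move=> e0; have [n0 fn0] := cf _ e0.
  exists n0 => // n /= n0n.
  apply: (@lorentz_norm_fatou _ _ _ _ mu_na _ _ p0 q0 _ (fun j => f (s j) - f n)%R).
  - exact: ltW.
  - exact: (@almost_uniform_norm_gt_le _ _ _ _ mu_na (fun j => f (s j)) g (f n) A).
  - exists n0 => // j /= n0j; apply/ltW/fn0 => //.
    exact: leq_trans (sj j).
have [_ SD _ _ _ NZ _] := lorentz_fun_quasi_seminorm_on.
exists g.
  (* With tolerance 1, g is the sum of g - f n0, of finite norm, and f n0. *)
  have [n0 _ /(_ _ (leqnn _)) Ngn] := Ng 1%R ltr01.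
  rewrite -(subrK (f n0) g); apply: SD => //.
  by apply: (le_lt_trans Ngn); rewrite ltry.
apply: cvge_to0 => [n|e e0]; first exact: lorentz_norm_ge0.
have := Ng _ (divr_gt0 e0 (ltr0n _ 2)); apply: filterS => n.
rewrite mulrCA mulfV// mulr1 => Ngn.
rewrite -(opprB g (f n)) -[(- (g - f n))%R]scaleN1r.
by rewrite /N lorentz_normZ// normrN1 mul1e.
Qed.

Local Open Scope quotient_scope.
Hypothesis mu_ac : monotone_autocontinuous_from_below mu.

Let qnormE := lorentz_qnorm_pi mu_na mu_rs mu_ac p0 q0.

(** The class map is linear and [qnormE] evaluates the norm on any representative, so each axiom
    descends from functions; definiteness is [lorentz_norm_eq0]. *)
Lemma lorentz_space_quasi_norm_on :
  quasi_norm_on (lorentz_space mu_na mu_rs p q) (lorentz_qnorm mu_na mu_rs p q).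
Proof.
have [S0 SD SZ N0 Nfin NZ [K K1 NK]] := lorentz_fun_quasi_seminorm_on.
split; first split.
- by exists 0%R.
- move=> _ _ [f Sf <-] [g Sg <-]; rewrite -pi_mfun_modD.
  exact: (imageP _ (SD _ _ Sf Sg)).
- move=> c _ [f Sf <-]; rewrite -pi_mfun_modZ.
  exact: (imageP _ (SZ c _ Sf)).
- by move=> _ [f Sf <-]; rewrite qnormE; exact: (N0 _ Sf).
- by move=> _ [f Sf <-]; rewrite qnormE; exact: (Nfin _ Sf).
- by move=> c _ [f Sf <-]; rewrite -pi_mfun_modZ !qnormE; exact: (NZ c _ Sf).
- exists K => // _ _ [f Sf <-] [g Sg <-].
  by rewrite -pi_mfun_modD !qnormE; exact: (NK _ _ Sf Sg).
move=> _ [f Sf <-]; rewrite qnormE => /(lorentz_norm_eq0 mu_na p0 q0) f0.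
exact/mfun_modP.
Qed.

Lemma lorentz_space_complete : property_C mu ->
  complete_wrt (lorentz_space mu_na mu_rs p q) (lorentz_qnorm mu_na mu_rs p q).
Proof.
move=> mu_C u Su cu.
have piB (f g : {mfun T >-> R}) : (\pi_(mfun_mod mu_na mu_rs) f -
    \pi_(mfun_mod mu_na mu_rs) g = \pi_(mfun_mod mu_na mu_rs) (f - g))%R.
  by rewrite pi_mfun_modD -[in RHS]scaleN1r pi_mfun_modZ scaleN1r.
(* Representatives are chosen within [lorentz_fun]; the norms of differences are unchanged, so
   completeness of the function space applies. *)
have /choice[f fu] : forall n, exists f,
    lorentz_fun mu p q f /\ \pi_(mfun_mod mu_na mu_rs) f = u n.
  by move=> n; have [f Sf fu] := Su n; exists f.
have [] := @lorentz_fun_complete mu_ac mu_C f.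
- by move=> n; have [] := fu n.
- move=> e /cu[n0 un0]; exists n0 => m n mn nn.
  have := un0 m n mn nn.
  by rewrite -(fu m).2 -(fu n).2 piB qnormE.
move=> g Sg fg; exists (\pi_(mfun_mod mu_na mu_rs) g); first by exists g.
suff -> : (fun n => lorentz_qnorm mu_na mu_rs p q
    (u n - \pi_(mfun_mod mu_na mu_rs) g)%R) = (fun n => N (f n - g)%R) by [].
by apply/funext => n; rewrite -(fu n).2 piB qnormE.
Qed.

End lorentz_complete.

Theorem corollary6p7 (d : measure_display) (T : measurableType d)
    (R : realType) (mu : set T -> \bar R) (p q : R)
    (mu_na : nonadditive_measure mu) (mu_rs : relaxed_subadditive mu)
    (mu_ac : monotone_autocontinuous_from_below mu) (mu_C : property_C mu)
    (p_gt0 : 0 < p) (q_gt0 : 0 < q) :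
  (quasi_seminorm_on (lorentz_fun mu p q)
     (fun f : {mfun T >-> R} => lorentz_norm mu p q f) /\
   complete_wrt (lorentz_fun mu p q)
     (fun f : {mfun T >-> R} => lorentz_norm mu p q f)) /\
  (quasi_norm_on (lorentz_space mu_na mu_rs p q)
     (lorentz_qnorm mu_na mu_rs p q) /\
   complete_wrt (lorentz_space mu_na mu_rs p q)
     (lorentz_qnorm mu_na mu_rs p q)).
Proof.
split; split.
- exact: lorentz_fun_quasi_seminorm_on.
- exact: lorentz_fun_complete.
- exact: lorentz_space_quasi_norm_on.
- exact: lorentz_space_complete.
Qed.
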